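(* Let $(X_n)_{n\ge0}$ be a time-homogeneous discrete-time Markov chain on a measurable space $S$ with Markov transition kernel $P(x,dy)$ and invariant probability measure $\mu$, started from $X_0\sim\mu$. Assume that $$\gamma:=\inf_{f\in L^2_0(\mu)\setminus\{0\}}\frac{\|(P-I)f\|}{\|f\|}>0.$$ Then for every integer $n\ge1$: (i) $\displaystyle \Delta_n\le\frac{2}{\sqrt{\gamma n}}$; (ii) $\displaystyle \max_{n\le k\le 2n}\Delta_k\ge\frac{1}{2\gamma n+3}$.
   Context: $L^2(\mu)$ is the space of complex-valued square-integrable functions with norm $\|\cdot\|$; $L^2_0(\mu)=\{g\in L^2(\mu):\int g\,d\mu=0\}$. $P$ acts by $Pg(x)=\int g(y)\,P(x,dy)$, and $\mu$ is invariant: $\int P(x,dy)\,\mu(dx)=\mu(dy)$. Write $\mu g=\int g\,d\mu$, $\mu_ng=\frac1n\sum_{i=0}^{n-1}g(X_i)$, $\operatorname{Var}_\mu(\mu_ng)=\mathbb E_\mu|\mu_ng-\mu g|^2$ where $\mathbb E_\mu$ is expectation with $X_0\sim\mu$, and $$\Delta_n:=\sup_{g\in L^2_0(\mu),\ \|g\|=1}\sqrt{\operatorname{Var}_\mu(\mu_ng)}.$$ Conventions in degenerate cases: $\inf\emptyset=+\infty$, $\sup\emptyset=0$, $1/\infty=0$. *)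

(* Defs.v *)
From HB Require Import structures.
From mathcomp Require Import all_boot all_order all_algebra.
From mathcomp Require Import all_classical all_reals all_analysis.
From mathcomp Require Import complex.
Set Implicit Arguments.
Unset Strict Implicit.
Unset Printing Implicit Defensive.
Import Order.TTheory GRing.Theory Num.Theory.
Import numFieldNormedType.Exports.
Local Open Scope classical_set_scope.
Local Open Scope complex_scope.
Local Open Scope ring_scope.

Definition cmeasurable d (T : measurableType d) (R : realType)
    (g : T -> R[i]) : Prop :=
  measurable_fun [set: T] (fun x => complex.Re (g x)) /\
  measurable_fun [set: T] (fun x => complex.Im (g x)).

(* Lebesgue integral of a complex-valued function; the value is meaningful
   when the real and imaginary parts of g are integrable. *)
Definition cintegral d (T : measurableType d) (R : realType)
    (m : {measure set T -> \bar R}) (g : T -> R[i]) : R[i] :=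
  Rintegral m [set: T] (fun x => complex.Re (g x)) +i*
  Rintegral m [set: T] (fun x => complex.Im (g x)).

Definition l2norm d (T : measurableType d) (R : realType)
    (m : {measure set T -> \bar R}) (g : T -> R[i]) : \bar R :=
  Lnorm m 2%:E (fun x => (ComplexField.Normc.normc (g x))%:E).

(* Functions, not classes modulo m-a.e. equality. *)
Definition L2 d (T : measurableType d) (R : realType)
    (m : {measure set T -> \bar R}) : set (T -> R[i]) :=
  [set g | cmeasurable g /\ (l2norm m g < +oo)%E].

Definition L20 d (T : measurableType d) (R : realType)
    (m : {measure set T -> \bar R}) : set (T -> R[i]) :=
  [set g | L2 m g /\ cintegral m g = 0].

Definition invariant_measure d (S : measurableType d) (R : realType)
    (P : R.-pker S ~> S) (mu : probability S R) : Prop :=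
  forall A, measurable A -> (\int[mu]_x P x A = mu A)%E.

(* For g in L2 mu with mu invariant, g is integrable with respect to P x for
   mu-almost every x; the values at the other points x are irrelevant. *)
Definition kernel_op d (S : measurableType d) (R : realType)
    (P : R.-pker S ~> S) (g : S -> R[i]) : S -> R[i] :=
  fun x => cintegral (P x) g.

(* The infimum is taken in the extended reals, so it is +oo when L20 mu is
   trivial. *)
Definition gamma d (S : measurableType d) (R : realType)
    (P : R.-pker S ~> S) (mu : probability S R) : \bar R :=
  ereal_inf [set (l2norm mu (fun x => kernel_op P f x - f x)%R /
                  l2norm mu f)%E |
             f in [set f : S -> R[i] |
                   L20 mu f /\ ~ {ae mu, forall x, f x = 0}]].

Definition past d d' (Omega : measurableType d') (S : measurableType d)
    (X : nat -> Omega -> S) (n : nat) : set (set Omega) :=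
  <<s [set B | exists i A, [/\ (i <= n)%N, measurable A & B = X i @^-1` A]] >>.

(* P (X n) A is a version of the conditional probability of X n.+1 in A given
   the sigma-algebra generated by X 0, ..., X n. *)
Definition markov_chain d d' (Omega : measurableType d') (S : measurableType d)
    (R : realType) (Pr : probability Omega R) (P : R.-pker S ~> S)
    (X : nat -> {RV Pr >-> S}) : Prop :=
  forall n A B, measurable A -> past (fun i => X i) n B ->
    (Pr (B `&` X n.+1 @^-1` A) = \int[Pr]_(w in B) P (X n w) A)%E.

Definition empirical_mean d d' (Omega : measurableType d')
    (S : measurableType d) (R : realType)
    (X : nat -> Omega -> S) (n : nat) (g : S -> R[i]) (w : Omega) : R[i] :=
  n%:R^-1 * \sum_(i < n) g (X i w).

Definition Var d d' (Omega : measurableType d') (S : measurableType d)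
    (R : realType) (Pr : probability Omega R) (mu : probability S R)
    (X : nat -> {RV Pr >-> S}) (n : nat) (g : S -> R[i]) : \bar R :=
  'E_Pr[(fun w => ComplexField.Normc.normc
                    (empirical_mean X n g w - cintegral mu g) ^+ 2)].

(* Supremum in [0, +oo]: 0 is added so that the supremum over the empty family
   is 0 rather than -oo. *)
Definition Delta d d' (Omega : measurableType d') (S : measurableType d)
    (R : realType) (Pr : probability Omega R) (mu : probability S R)
    (X : nat -> {RV Pr >-> S}) (n : nat) : \bar R :=
  ereal_sup (0%E |` [set sqrte (Var mu X n g) |
                     g in [set g | L20 mu g /\ l2norm mu g = 1%E]]).

(* Main.v *)
Require Import Defs.
From HB Require Import structures.
From mathcomp Require Import all_boot all_order all_algebra.
From mathcomp Require Import all_classical all_reals all_analysis.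
From mathcomp Require Import measurable_realfun.
From mathcomp Require Import complex ring lra.
Set Implicit Arguments.
Unset Strict Implicit.
Unset Printing Implicit Defensive.
Import Order.TTheory GRing.Theory Num.Theory.
Import numFieldNormedType.Exports.
Local Open Scope classical_set_scope.

(** Write [Q] for the Markov operator, a contraction of [L2 mu] that preserves
the mean, [s_k u = u + Q u + ... + Q^(k-1) u], and [S_k u] for the sum of [u]
along the first [k] steps of the chain, so that the variance of the empirical
mean of a centred [u] is [|S_k u|^2 / k^2]. Real and imaginary parts do not
interact, and everything is proved for real functions first. The link between
the operator and the chain is the correlation identity
[E (u (X_i) v (X_j)) = <u, Q^(j-i) v>] for [i <= j] ([ip_chain_L2_corr]).

Upper bound. Since [(Q - I) s_k u = Q^k u - u] has norm at most [2 |u|], the gap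
gives [gamma |s_k u| <= 2 |u|] for every [k] ([orbit_sum_le]). Expanding the
square, [|S_(n+1) u|^2 - |S_n u|^2 = 2 <u, s_(n+1) u> - |u|^2], which is at most
[4 |u|^2 / gamma]. Hence [|S_n u|^2 <= 4 n |u|^2 / gamma] ([path_sum_le]), which
is the bound on [Delta n] after division by [n^2].

Lower bound. Conditioning on the initial state gives [|s_k u| <= |S_k u|]
([orbit_sum_le_path_sum]). If [Delta k <= e] for all [n <= k <= 2 n], then
[|s_k u| <= k e |u|] for those [k], and summing the telescoping identity
[u - Q^k u = s_k (u - Q u)] over [n <= k < 2 n] yields
[(1 - e) |u| <= 2 n e |u - Q u|] ([gap_of_orbit_sum]). Taking the infimum over
[u], [1 - e <= 2 n e gamma] ([gamma_ge_of_Delta_le]), so that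
[e >= 1 / (1 + 2 n gamma)], which exceeds the claimed bound.

If there is no nonnull centred function, [gamma] is infinite, every [Delta k] is
zero, and both inequalities hold trivially. *)

(** * Semi-inner products *)

Local Open Scope ring_scope.

Definition semi_inner (R : realType) (V : lmodType R) (B : V -> V -> R) :=
  [/\ forall u v, B u v = B v u,
      forall a u v w, B (a *: u + v) w = a * B u w + B v w
    & forall u, 0 <= B u u].

Definition seminorm (R : realType) (V : lmodType R) (B : V -> V -> R) (u : V) :=
  Num.sqrt (B u u).

Section SemiInner.
Context (R : realType) (V : lmodType R) (B : V -> V -> R).
Hypothesis ipB : semi_inner B.
Local Notation nrm := (seminorm B).

Let BC u v : B u v = B v u. Proof. by case: ipB. Qed.

Lemma innerDl u v w : B (u + v) w = B u w + B v w.
Proof. by case: ipB => _ /(_ 1 u v w); rewrite scale1r mul1r. Qed.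

Lemma innerDr u v w : B w (u + v) = B w u + B w v.
Proof. by rewrite BC innerDl !(BC w). Qed.

Lemma inner0l w : B 0 w = 0.
Proof. by apply: (addrI (B 0 w)); rewrite -innerDl !addr0. Qed.

Lemma innerZl a u w : B (a *: u) w = a * B u w.
Proof. by case: ipB => _ /(_ a u 0 w); rewrite !addr0 inner0l addr0. Qed.

Lemma innerZr a u w : B w (a *: u) = a * B w u.
Proof. by rewrite BC innerZl BC. Qed.

Lemma innerNl u w : B (- u) w = - B u w.
Proof. by rewrite -scaleN1r innerZl mulN1r. Qed.

Lemma innerBl u v w : B (u - v) w = B u w - B v w.
Proof. by rewrite innerDl innerNl. Qed.

Lemma innerBr u v w : B w (u - v) = B w u - B w v.
Proof. by rewrite BC innerBl !(BC w). Qed.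

Lemma inner_suml (I : Type) (r : seq I) (P : pred I) (F : I -> V) w :
  B (\sum_(i <- r | P i) F i) w = \sum_(i <- r | P i) B (F i) w.
Proof.
by apply: (big_morph (B^~ w)) => [u v|]; [exact: innerDl | exact: inner0l].
Qed.

Lemma inner_sumr (I : Type) (r : seq I) (P : pred I) (F : I -> V) w :
  B w (\sum_(i <- r | P i) F i) = \sum_(i <- r | P i) B w (F i).
Proof. by rewrite BC inner_suml; apply: eq_bigr => i _; exact: BC. Qed.

Lemma seminorm_ge0 u : 0 <= nrm u. Proof. exact: sqrtr_ge0. Qed.

Lemma sqr_seminorm u : nrm u ^+ 2 = B u u.
Proof. by rewrite sqr_sqrtr//; case: ipB. Qed.

Lemma inner_sqrD u v : B (u + v) (u + v) = B u u + 2 * B u v + B v v.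
Proof. rewrite innerDl !innerDr (BC v u); ring. Qed.

(** The quadratic [t |-> B (u + t v) (u + t v)] is nonnegative; evaluate it at
its minimum, or, when [B v v = 0] makes it affine, at a point where a nonzero
slope would make it equal to [-1]. *)
Lemma inner_CS_sqr u v : B u v ^+ 2 <= B u u * B v v.
Proof.
have pos t : 0 <= B u u + 2 * t * B u v + t ^+ 2 * B v v.
  have [_ _ /(_ (u + t *: v))] := ipB.
  rewrite inner_sqrD innerZr innerZl innerZr; congr (_ <= _); ring.
have v0 : 0 <= B v v by case: ipB.
have [vv0|vvN0] := eqVneq (B v v) 0.
  rewrite vv0 mulr0; have [->|uvN0] := eqVneq (B u v) 0; first by rewrite expr0n.
  have := pos (- (B u u + 1) / (2 * B u v)).
  rewrite vv0 mulr0 addr0 [X in _ + X](_ : _ = - (B u u + 1)); last first.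
    by field.
  by move=> h; exfalso; lra.
have vv_gt0 : 0 < B v v by rewrite lt_def vvN0.
have := pos (- B u v / B v v).
rewrite [X in 0 <= X](_ : _ = (B u u * B v v - B u v ^+ 2) / B v v); last by field.
by rewrite pmulr_lge0 ?invr_gt0// subr_ge0.
Qed.

Lemma inner_CS u v : B u v <= nrm u * nrm v.
Proof.
rewrite (le_trans (ler_norm _))// -ler_sqr ?nnegrE ?mulr_ge0 ?seminorm_ge0//.
by rewrite real_normK ?num_real// exprMn !sqr_seminorm inner_CS_sqr.
Qed.

Lemma ler_seminormD u v : nrm (u + v) <= nrm u + nrm v.
Proof.
rewrite -ler_sqr ?nnegrE ?addr_ge0 ?seminorm_ge0//.
rewrite sqrrD !sqr_seminorm inner_sqrD lerD2r lerD2l mulr_natl.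
by rewrite ler_wMn2r// inner_CS.
Qed.

Lemma seminormZ a u : nrm (a *: u) = `|a| * nrm u.
Proof.
rewrite /seminorm innerZl innerZr mulrA -expr2 sqrtrM ?sqr_ge0//.
by rewrite sqrtr_sqr.
Qed.

Lemma seminormN u : nrm (- u) = nrm u.
Proof. by rewrite -scaleN1r seminormZ normrN1 mul1r. Qed.

Lemma seminorm0 : nrm 0 = 0.
Proof. by rewrite /seminorm inner0l sqrtr0. Qed.

Lemma seminormB u v : nrm (u - v) = nrm (v - u).
Proof. by rewrite -seminormN opprB. Qed.

Lemma ler_seminormB u v : nrm (u - v) <= nrm u + nrm v.
Proof. by rewrite (le_trans (ler_seminormD _ _))// seminormN. Qed.

Lemma ler_seminorm_sum (n : nat) (F : 'I_n -> V) :
  nrm (\sum_(i < n) F i) <= \sum_(i < n) nrm (F i).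
Proof.
elim: n F => [|n IH] F; first by rewrite !big_ord0 seminorm0.
by rewrite !big_ord_recr/= (le_trans (ler_seminormD _ _))// lerD2r.
Qed.

(** In [L2] this is equality almost everywhere. A Markov operator on functions
is additive only in this sense, because the integral of a function against
[P x] is meaningful for almost every [x] only. *)
Definition nulleq u v := nrm (u - v) = 0.

Lemma nulleq_refl u : nulleq u u. Proof. by rewrite /nulleq subrr seminorm0. Qed.

Lemma nulleq_sym u v : nulleq u v -> nulleq v u.
Proof. by rewrite /nulleq seminormB. Qed.

Lemma nulleq_trans v u w : nulleq u v -> nulleq v w -> nulleq u w.
Proof.
rewrite /nulleq => uv vw; apply/eqP; rewrite eq_le seminorm_ge0 andbT.
by rewrite -(subrKA v u) (le_trans (ler_seminormD _ _))// uv vw addr0.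
Qed.

Lemma nulleqD u v u' v' :
  nulleq u u' -> nulleq v v' -> nulleq (u + v) (u' + v').
Proof.
rewrite /nulleq => uu vv; apply/eqP; rewrite eq_le seminorm_ge0 andbT.
by rewrite opprD addrACA (le_trans (ler_seminormD _ _))// uu vv addr0.
Qed.

Lemma nulleq_sum (n : nat) (F G : 'I_n -> V) :
  (forall i, nulleq (F i) (G i)) -> nulleq (\sum_(i < n) F i) (\sum_(i < n) G i).
Proof.
elim: n F G => [|n IH] F G FG; first by rewrite !big_ord0; exact: nulleq_refl.
by rewrite !big_ord_recr/=; apply: nulleqD => //; exact: IH.
Qed.

Lemma nulleq_seminorm u v : nulleq u v -> nrm u = nrm v.
Proof.
have le u' v' : nulleq u' v' -> nrm u' <= nrm v'.
  move=> uv; rewrite -[u'](subrK v') (le_trans (ler_seminormD _ _))//.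
  by rewrite uv add0r.
by move=> uv; apply/eqP; rewrite eq_le !le//; exact: nulleq_sym.
Qed.

Lemma nulleq_inner w u v : nulleq u v -> B w u = B w v.
Proof.
move=> uv; apply/eqP; rewrite -subr_eq0 -innerBr -sqrf_eq0 eq_le sqr_ge0 andbT.
rewrite (le_trans (inner_CS_sqr _ _))// -(sqr_seminorm (u - v)).
by rewrite uv expr0n mulr0.
Qed.

End SemiInner.

(** * Orbit sums of a contraction and sums along a dilation *)

Section Contraction.
Context (R : realType) (V : lmodType R) (B : V -> V -> R).
Hypothesis ipB : semi_inner B.
Local Notation nrm := (seminorm B).
Local Notation "u === v" := (nulleq B u v) (at level 70).
Context (Q : V -> V) (M : V -> R).
Hypothesis QD : forall u v, Q (u + v) === Q u + Q v.
Hypothesis Qcontr : forall u, nrm (Q u) <= nrm u.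
Hypothesis M_lin : forall a u v, M (a *: u + v) = a * M u + M v.
Hypothesis MQ : forall u, M (Q u) = M u.

(** [m] times the Cesaro mean of the orbit of [u]. *)
Definition orbit_sum (m : nat) (u : V) := \sum_(i < m) iter i Q u.
Local Notation s := orbit_sum.

Lemma meanD u v : M (u + v) = M u + M v.
Proof. by have := M_lin 1 u v; rewrite scale1r mul1r. Qed.

Lemma mean0 : M 0 = 0.
Proof. by apply: (addrI (M 0)); rewrite -meanD !addr0. Qed.

Lemma meanB u v : M (u - v) = M u - M v.
Proof.
by have := M_lin (-1) v u; rewrite scaleN1r mulN1r addrC => ->; rewrite addrC.
Qed.

Lemma mean_iter i u : M (iter i Q u) = M u.
Proof. by elim: i => //= i <-; exact: MQ. Qed.

Lemma mean_orbit_sum m u : M u = 0 -> M (s m u) = 0.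
Proof.
move=> u0; rewrite /s (big_morph M meanD mean0) big1// => i _.
by rewrite mean_iter.
Qed.

Lemma opB u v : Q (u - v) === Q u - Q v.
Proof.
have /(nulleq_sym ipB) h := QD (u - v) v; rewrite subrK in h.
have := nulleqD ipB h (nulleq_refl ipB (- Q v)).
by rewrite addrK.
Qed.

Lemma op_nulleq u v : u === v -> Q u === Q v.
Proof.
move=> uv; have /(nulleq_sym ipB)/(nulleq_seminorm ipB) h := opB u v.
apply/eqP; rewrite eq_le seminorm_ge0 andbT h.
by rewrite (le_trans (Qcontr _))// uv.
Qed.

Lemma iter_opB i u v : iter i Q (u - v) === iter i Q u - iter i Q v.
Proof.
elim: i => [|i IH]/=; first exact: nulleq_refl.
exact: (nulleq_trans ipB (op_nulleq IH) (opB _ _)).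
Qed.

Lemma iter_contraction i u : nrm (iter i Q u) <= nrm u.
Proof. by elim: i => //= i IH; exact: le_trans IH. Qed.

(** For null vectors, which cannot be normalised. *)
Lemma orbit_sum_bound m u : nrm (s m u) <= m%:R * nrm u.
Proof.
rewrite (le_trans (ler_seminorm_sum ipB _))// mulr_natl -[X in _ *+ X](card_ord m).
by rewrite -sumr_const; apply: ler_sum => i _; exact: iter_contraction.
Qed.

Lemma op_orbit_sum m u : Q (s m u) - s m u === iter m Q u - u.
Proof.
rewrite /s; elim: m => [|m IH].
  rewrite big_ord0 /= subrr subr0.
  by have := opB 0 0; rewrite !subrr.
rewrite big_ord_recr/=; set t := \sum_(i < m) _ in IH *.
have h := nulleqD ipB (QD t (iter m Q u)) (nulleq_refl ipB (- (t + iter m Q u))).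
apply: (nulleq_trans ipB h); rewrite opprD addrACA.
have := nulleqD ipB IH (nulleq_refl ipB (Q (iter m Q u) - iter m Q u)).
by congr (_ === _); rewrite addrC addrA subrK.
Qed.

Lemma orbit_sum_telescope m u : s m (u - Q u) === u - iter m Q u.
Proof.
rewrite /s.
have h : \sum_(i < m) iter i Q (u - Q u) ===
         \sum_(i < m) (iter i Q u - iter i Q (Q u)).
  by apply: (nulleq_sum ipB) => i; exact: iter_opB.
apply: (nulleq_trans ipB h); under eq_bigr do rewrite -iterSr.
have -> : \sum_(i < m) (iter i Q u - iter i.+1 Q u) = u - iter m Q u.
  elim: m {h} => [|m IH]; first by rewrite big_ord0 subrr.
  by rewrite big_ord_recr IH /= addrA subrK.
exact: nulleq_refl.
Qed.

(** The sum telescopes under [Q - I]: [(Q - I) s = Q^m u - u] has seminorm at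
most [2 nrm u] by contraction, and the gap turns this into a bound on [s]
itself that does not grow with [m]. *)
Lemma orbit_sum_le c m u : (forall v, M v = 0 -> c * nrm v <= nrm (Q v - v)) ->
  M u = 0 -> c * nrm (s m u) <= 2 * nrm u.
Proof.
move=> gap u0; rewrite (le_trans (gap _ (mean_orbit_sum m u0)))//.
rewrite (nulleq_seminorm ipB (op_orbit_sum m u)).
rewrite (le_trans (ler_seminormB ipB _ _))// mulr_natl mulr2n lerD2r.
exact: iter_contraction.
Qed.

(** If all Cesaro means of length between [n] and [2 n] have operator norm at
most [e], then averaging [u - Q^k u = s_k (u - Q u)] over [n <= k < 2 n] gives
[u = (1/n) s_n (Q^n u) + (1/n) \sum_k s_k (u - Q u)]. The first term is a
Cesaro mean of [Q^n u], of seminorm at most [e nrm u]; each summand in the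
second has seminorm at most [2 n e nrm (u - Q u)]. *)
Lemma gap_of_orbit_sum (n : nat) (e : R) : (0 < n)%N ->
  (forall k u, (n <= k <= 2 * n)%N -> M u = 0 -> nrm (s k u) <= k%:R * e * nrm u) ->
  0 <= e ->
  forall u, M u = 0 -> (1 - e) * nrm u <= 2 * n%:R * e * nrm (Q u - u).
Proof.
move=> n0 He e0 u u0.
have n0R : 0 < n%:R :> R by rewrite ltr0n.
set w := u - Q u.
have w0 : M w = 0 by rewrite meanB MQ subrr.
pose T := \sum_(k < n) s (n + k) w.
have TE : T === n%:R *: u - s n (iter n Q u).
  apply: (nulleq_trans ipB (v := \sum_(k < n) (u - iter (n + k) Q u))).
    by apply: (nulleq_sum ipB) => k; exact: orbit_sum_telescope.
  rewrite big_split/= sumr_const card_ord sumrN scaler_nat.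
  under [X in _ - X]eq_bigr do rewrite addnC iterD.
  exact: nulleq_refl.
have NT : nrm T <= n%:R * (2 * n%:R * e * nrm w).
  apply: (le_trans (ler_seminorm_sum ipB _)).
  rewrite mulr_natl -[X in _ *+ X](card_ord n) -sumr_const.
  apply: ler_sum => k _.
  apply: (le_trans (He _ _ _ w0)).
    by rewrite leq_addr mul2n -addnn leq_add2l ltnW.
  rewrite ler_wpM2r ?seminorm_ge0// ler_wpM2r//.
  by rewrite -natrM ler_nat mul2n -addnn leq_add2l ltnW.
have Ns : nrm (s n (iter n Q u)) <= n%:R * e * nrm u.
  apply: (le_trans (He _ _ _ _)); first by rewrite leqnn mul2n -addnn leq_addr.
    by rewrite mean_iter.
  by rewrite ler_wpM2l ?mulr_ge0 ?ler0n// iter_contraction.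
have : n%:R * nrm u <= n%:R * e * nrm u + n%:R * (2 * n%:R * e * nrm w).
  rewrite -[n%:R * nrm u](_ : nrm (n%:R *: u) = _); last first.
    by rewrite (seminormZ ipB) ger0_norm ?ler0n.
  rewrite -[n%:R *: u](subrKC (s n (iter n Q u))).
  apply: (le_trans (ler_seminormD ipB _ _)).
  by rewrite -(nulleq_seminorm ipB TE) lerD.
rewrite -mulrA -mulrDr ler_pM2l// -lerBlDl => h.
by rewrite (seminormB ipB) mulrBl mul1r.
Qed.

(** [U i u] stands for the observable [u] read on the chain at time [i]; the
hypothesis [corr] is all that the norms of path sums depend on: stationarity
and the Markov property, integrated. *)
Section Dilation.
Context (W : lmodType R) (C : W -> W -> R) (U : nat -> V -> W).
Hypothesis ipC : semi_inner C.
Hypothesis corr : forall i j u v, (i <= j)%N ->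
  C (U i u) (U j v) = B u (iter (j - i) Q v).

Definition path_sum (n : nat) (u : V) := \sum_(i < n) U i u.

(** The increment of the squared norm from [n] to [n + 1] is
[2 B u (s_(n+1) u) - B u u], because correlations of the new term with the past
add up to an orbit sum; by [orbit_sum_le] it is at most [4 / c * B u u]. Only
one factor [1 / c] appears since [u] itself is paired with the orbit sum. *)
Lemma path_sum_le c n u : 0 < c ->
  (forall v, M v = 0 -> c * nrm v <= nrm (Q v - v)) -> M u = 0 ->
  C (path_sum n u) (path_sum n u) <= 4 * n%:R / c * B u u.
Proof.
move=> c0 gap u0; have NB := sqr_seminorm ipB u.
elim: n => [|n IH].
  by rewrite /path_sum big_ord0 (inner0l ipC) mulr0 !mul0r.
rewrite /path_sum big_ord_recr/= (inner_sqrD ipC) -!/(path_sum _ _).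
rewrite corr// subnn/=.
have -> : C (path_sum n u) (U n u) = B u (s n.+1 u) - B u u.
  rewrite (inner_suml ipC) /s big_ord_recl/= (innerDr ipB) addrC addKr.
  rewrite (inner_sumr ipB) (reindex_inj rev_ord_inj)/=.
  apply: eq_bigr => i _; rewrite corr ?leq_subr//.
  by rewrite subKn.
have h1 : B u (s n.+1 u) <= 2 / c * B u u.
  rewrite (le_trans (inner_CS ipB _ _))// -NB expr2 mulrCA.
  rewrite ler_wpM2l ?seminorm_ge0// mulrAC ler_pdivlMr// mulrC.
  exact: orbit_sum_le.
have := sqr_ge0 (nrm u); rewrite NB => Bu0.
rewrite -[n.+1%:R]natr1 (_ : 4 * (n%:R + 1) / c * B u u =
  4 * n%:R / c * B u u + 2 * (2 / c * B u u)); last by ring.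
lra.
Qed.

(** The orbit sum is the conditional expectation of the path sum given the
initial state, and conditioning contracts. The pairing with [U 0 (s k u)]
replaces the conditional expectation. *)
Lemma orbit_sum_le_path_sum k u :
  nrm (s k u) <= seminorm C (path_sum k u).
Proof.
have [->|Ns0] := eqVneq (nrm (s k u)) 0; first exact: seminorm_ge0.
have {Ns0}Ns : 0 < nrm (s k u) by rewrite lt_def Ns0 seminorm_ge0.
rewrite -(ler_pM2l Ns) -expr2 (sqr_seminorm ipB).
have -> : B (s k u) (s k u) = C (U 0%N (s k u)) (path_sum k u).
  rewrite (inner_sumr ipC) {2}/s (inner_sumr ipB).
  by apply: eq_bigr => i _; rewrite corr// subn0.
apply: (le_trans (inner_CS ipC _ _)).
by rewrite {1}/seminorm corr// subnn.
Qed.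

End Dilation.
End Contraction.

(** * Integrals against kernels *)

Section KernelIntegral.
Import HBNNSimple.
Local Open Scope ereal_scope.
Context d d' (R : realType) (Omega : measurableType d') (T : measurableType d).
Context (m : {measure set Omega -> \bar R}).
Context (K : Omega -> {measure set T -> \bar R}).
Hypothesis mK : forall A, measurable A -> measurable_fun setT (fun w => K w A).
Context (h : Omega -> \bar R).
Hypothesis mh : measurable_fun setT h.
Hypothesis h0 : forall w, 0 <= h w.
Hypothesis hfin : forall w, h w \is a fin_num.

Lemma integral_kernel_nnsfun (f : {nnsfun T >-> R}) :
  \int[m]_w (h w * \int[K w]_y (f y)%:E) =
  \sum_(r \in range f) r%:E * \int[m]_w (h w * K w (f @^-1` [set r])).
Proof.
have mf r : measurable (f @^-1` [set r]) by exact: measurable_funPTI.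
have mhK r : measurable_fun setT (fun w => h w * K w (f @^-1` [set r])).
  by apply: emeasurable_funM => //; exact: mK.
transitivity (\int[m]_w \sum_(r \in range f)
    (r%:E * (h w * K w (f @^-1` [set r])))).
  apply: eq_integral => w _.
  rewrite integralT_nnsfun sintegralE ge0_mule_fsumr.
    by apply: eq_fsbigr => r _; rewrite muleCA.
  by move=> r; exact: nnsfun_mulemu_ge0.
rewrite ge0_integral_fsum//.
- apply: eq_fsbigr => r; rewrite inE => -[y _ fyr].
  rewrite ge0_integralZl//; first by move=> w _; rewrite mule_ge0.
  by rewrite lee_fin -fyr.
- by move=> r; apply: emeasurable_funM.
- move=> r w _; rewrite muleCA mule_ge0//; exact: nnsfun_mulemu_ge0.
Qed.

Lemma integral_kernel_lim (f : T -> \bar R) (f0 : forall y, 0 <= f y)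
    (mf : measurable_fun setT f) :
  \int[m]_w (h w * \int[K w]_y f y) =
  limn (fun n => \int[m]_w (h w *
    \int[K w]_y (nnsfun_approx measurableT mf n y)%:E)).
Proof.
set f_ := nnsfun_approx measurableT mf.
have f_nd n y : {homo (fun n => (f_ n y)%:E) : a b / (a <= b)%N >-> a <= b}.
  by move=> a b ab; rewrite lee_fin; exact/lefP/nd_nnsfun_approx.
have Inn w n : 0 <= \int[K w]_y (f_ n y)%:E.
  by apply: integral_ge0 => y _; rewrite lee_fin.
have Ind w : {homo (fun n => \int[K w]_y (f_ n y)%:E) :
    a b / (a <= b)%N >-> a <= b}.
  move=> a b ab; apply: ge0_le_integral => //.
  - by move=> y _; rewrite lee_fin.
  - exact/measurable_EFinP.
  - exact/measurable_EFinP.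
  - by move=> y _; exact: f_nd.
have mI n : measurable_fun setT (fun w => \int[K w]_y (f_ n y)%:E).
  apply: measurable_fun_integral_kernel => //; last exact/measurable_EFinP.
  by move=> y; rewrite lee_fin.
rewrite -monotone_convergence//.
- apply: eq_integral => w _.
  rewrite limeMl//; last by apply: ereal_nondecreasing_is_cvgn; exact: Ind.
  congr (_ * _); rewrite -monotone_convergence//.
  + apply: eq_integral => y _; apply/esym/cvg_lim => //.
    exact: cvg_nnsfun_approx.
  + by move=> n; exact/measurable_EFinP.
  + by move=> n y _; rewrite lee_fin.
  + by move=> y _; exact: f_nd.
- by move=> n; exact: emeasurable_funM.
- by move=> n w _; rewrite mule_ge0.
- by move=> w _ a b ab; apply: lee_wpmul2l => //; exact: Ind.
Qed.

End KernelIntegral.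

Section EqIntegralKernel.
Import HBNNSimple.
Local Open Scope ereal_scope.

(** Two weighted mixtures of measures that agree on sets agree on nonnegative
measurable functions. Dirac kernels are allowed, so that integrals of
[f \o Y] are covered with [K w = \d_(Y w)]. *)
Lemma eq_integral_kernel d d' d'' (R : realType) (T : measurableType d)
    (O1 : measurableType d') (O2 : measurableType d'')
    (m1 : {measure set O1 -> \bar R}) (m2 : {measure set O2 -> \bar R})
    (K1 : O1 -> {measure set T -> \bar R}) (K2 : O2 -> {measure set T -> \bar R})
    (h1 : O1 -> \bar R) (h2 : O2 -> \bar R) :
  (forall A, measurable A -> measurable_fun setT (fun w => K1 w A)) ->
  (forall A, measurable A -> measurable_fun setT (fun w => K2 w A)) ->
  measurable_fun setT h1 -> measurable_fun setT h2 ->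
  (forall w, 0 <= h1 w) -> (forall w, 0 <= h2 w) ->
  (forall w, h1 w \is a fin_num) -> (forall w, h2 w \is a fin_num) ->
  (forall A, measurable A ->
     \int[m1]_w (h1 w * K1 w A) = \int[m2]_w (h2 w * K2 w A)) ->
  forall f : T -> \bar R, (forall y, 0 <= f y) -> measurable_fun setT f ->
    \int[m1]_w (h1 w * \int[K1 w]_y f y) = \int[m2]_w (h2 w * \int[K2 w]_y f y).
Proof.
move=> mK1 mK2 mh1 mh2 h10 h20 h1f h2f hA f f0 mf.
rewrite (integral_kernel_lim m1 mK1 mh1 h10 h1f f0 mf).
rewrite (integral_kernel_lim m2 mK2 mh2 h20 h2f f0 mf).
apply: congr_lim; apply/funext => n.
rewrite !integral_kernel_nnsfun//; apply: eq_fsbigr => r _.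
by rewrite hA//; exact: measurable_funPTI.
Qed.

End EqIntegralKernel.

(** * Square-integrable real functions as a semi-inner product space *)

Notation L2space mu := (LfunType mu (lee1n 2)).

Section L2space.
Context d (T : measurableType d) (R : realType) (mu : {measure set T -> \bar R}).

Lemma mem_Lfun2 (f : T -> R) : measurable_fun setT f ->
  (\int[mu]_x (f x ^+ 2)%:E < +oo)%E -> f \in Lfun mu 2%:E.
Proof.
move=> mf fy; rewrite inE; apply/andP; split; rewrite inE//=.
rewrite /finite_norm unlock poweR_lty//.
under eq_integral do rewrite /= powR_mulrn// real_normK ?num_real//.
exact: fy.
Qed.

Lemma measurable_L2space (u : L2space mu) : measurable_fun setT u.
Proof. exact: measurable_funPT. Qed.

Lemma integrable_mulL2 (u v : L2space mu) :
  mu.-integrable setT (EFin \o (fun x => u x * v x)).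
Proof.
by apply/Lfun1_integrable; apply: Lfun2_mul_Lfun1; exact: LfunP.
Qed.

Lemma L2space_lty (u : L2space mu) : (\int[mu]_x (u x ^+ 2)%:E < +oo)%E.
Proof.
have /integrableP[_] := integrable_mulL2 u u.
by under eq_integral do rewrite /= ger0_norm -?expr2 ?sqr_ge0//.
Qed.

Definition ipL2 (u v : L2space mu) : R := \int[mu]_x (u x * v x).

Lemma ipL2_semi_inner : semi_inner ipL2.
Proof.
split => [u v|a u v w|u]; rewrite /ipL2.
- by apply: eq_Rintegral => x _; rewrite mulrC.
- rewrite -RintegralZl//; last exact: integrable_mulL2.
  rewrite -RintegralD//; last first.
  + exact: integrable_mulL2.
  + apply: (eq_integrable _ (EFin \o (fun x => (a *: u) x * w x))) => //.
      by move=> x _ /=; rewrite mulrA.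
    exact: integrable_mulL2.
  + by apply: eq_Rintegral => x _ /=; rewrite mulrA -mulrDl.
- by apply: Rintegral_ge0 => x _; rewrite -expr2 sqr_ge0.
Qed.

Lemma EFin_ipL2 (u : L2space mu) :
  (ipL2 u u)%:E = (\int[mu]_x (u x ^+ 2)%:E)%E.
Proof.
rewrite /ipL2 /Rintegral fineK//.
by apply: integrable_fin_num => //; exact: integrable_mulL2.
Qed.

Lemma Lfun2_funrpos (u : L2space mu) : u^\+ \in Lfun mu 2%:E.
Proof.
have mu' := measurable_L2space u.
apply: mem_Lfun2; first exact: measurable_funrpos.
apply: le_lt_trans (L2space_lty u); apply: ge0_le_integral => //.
- by move=> x _; rewrite lee_fin sqr_ge0.
- by apply/measurable_EFinP/measurable_funX/measurable_funrpos.
- by apply/measurable_EFinP/measurable_funX.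
- move=> x _; rewrite lee_fin /funrpos /Num.max; case: ifP => // _.
  by rewrite expr0n sqr_ge0.
Qed.

Lemma Lfun2_funrneg (u : L2space mu) : u^\- \in Lfun mu 2%:E.
Proof.
by have := Lfun2_funrpos (- u); congr (_ \in _).
Qed.

(** The positive and negative parts reduce bilinear identities on [L2] to
nonnegative functions, where integrals are never undefined. *)
Definition posL2 (u : L2space mu) : L2space mu := Lfun_Sub _ (Lfun2_funrpos u).
Definition negL2 (u : L2space mu) : L2space mu := Lfun_Sub _ (Lfun2_funrneg u).

Lemma posL2B (u : L2space mu) : u = posL2 u - negL2 u.
Proof.
apply/LfuneqP => x /=; have /(congr1 (@^~ x)) := funrposBneg u.
by move=> /= <-.
Qed.

Lemma ae_nulleq (u v : L2space mu) :
  {ae mu, forall x, u x = v x} -> nulleq ipL2 u v.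
Proof.
move=> uv; rewrite /nulleq /seminorm; suff -> : ipL2 (u - v) (u - v) = 0.
  by rewrite sqrtr0.
apply/EFin_inj; rewrite EFin_ipL2.
transitivity (\int[mu]_x (cst 0 x : \bar R))%E; last exact: integral0.
apply: ae_eq_integral => //.
  by apply/measurable_EFinP/measurable_funX/measurable_L2space.
by apply: filterS uv => x uvx _; rewrite -[(u - v) x]/(u x - v x) uvx subrr expr0n.
Qed.

End L2space.

Section L2prob.
Context d (T : measurableType d) (R : realType) (mu : probability T R).

Lemma integrable_L2space (u : L2space mu) : mu.-integrable setT (EFin \o u).
Proof.
apply/Lfun1_integrable; apply: Lfun_subset12; last exact: LfunP.
exact: fin_num_measure.
Qed.

Definition meanL2 (u : L2space mu) : R := \int[mu]_x u x.

Lemma meanL2_linear a (u v : L2space mu) :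
  meanL2 (a *: u + v) = a * meanL2 u + meanL2 v.
Proof.
rewrite /meanL2 -RintegralZl//; last exact: integrable_L2space.
rewrite -RintegralD//; last exact: integrable_L2space.
exact: (integrable_L2space (a *: u)).
Qed.

End L2prob.

(** Jensen's inequality for the square, from Cauchy-Schwarz against [1]. *)
Lemma Rintegral_sqr_le d (T : measurableType d) (R : realType)
    (mu : {measure set T -> \bar R}) (f : T -> R) : mu setT = 1%E ->
  measurable_fun setT f ->
  (((\int[mu]_x f x) ^+ 2)%:E <= \int[mu]_x (f x ^+ 2)%:E)%E.
Proof.
move=> mu1 mf; have [->|] := eqVneq (\int[mu]_x (f x ^+ 2)%:E)%E +oo%E.
  exact: leey.
rewrite -ltey => fy.
pose u : L2space mu := Lfun_Sub (lee1n 2) (mem_Lfun2 mf fy).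
have o2 : cst 1 \in Lfun mu 2%:E.
  apply: mem_Lfun2 => //; under eq_integral do rewrite expr1n.
  by rewrite integral_cst// mul1e mu1 ltry.
pose o : L2space mu := Lfun_Sub (lee1n 2) o2.
have := inner_CS_sqr (ipL2_semi_inner mu) u o.
rewrite -lee_fin [leRHS]EFinM !EFin_ipL2 /=.
under [X in (_ <= _ * X)%E]eq_integral do rewrite expr1n.
rewrite integral_cst// mul1e mu1 mule1; congr (_ <= _)%E.
by congr (_ ^+ 2)%:E; apply: eq_Rintegral => x _ /=; rewrite mulr1.
Qed.

(** * The Markov operator on square-integrable functions *)

Section MarkovOperator.
Context d (S : measurableType d) (R : realType).
Context (P : R.-pker S ~> S) (mu : probability S R).
Hypothesis mu_inv : invariant_measure P mu.

Lemma ge0_integral_invariant (f : S -> \bar R) :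
  (forall x, 0 <= f x)%E -> measurable_fun setT f ->
  (\int[mu]_x \int[P x]_y f y = \int[mu]_x f x)%E.
Proof.
move=> f0 mf.
transitivity (\int[mu]_x (cst 1 x * \int[P x]_y f y))%E.
  by apply: eq_integral => x _; rewrite mul1e.
transitivity (\int[mu]_x (cst 1 x * \int[\d_x]_y f y))%E; last first.
  by apply: eq_integral => x _; rewrite mul1e integral_dirac// diracT mul1e.
apply: eq_integral_kernel => //.
- by move=> A mA; exact: measurable_kernel.
- by move=> A mA; exact: measurable_fun_dirac.
- move=> A mA; under eq_integral do rewrite mul1e.
  rewrite mu_inv//; under eq_integral do rewrite mul1e.
  by rewrite integral_indic// setIT.
Qed.

Let mP A : measurable A -> measurable_fun setT (P ^~ A).
Proof. by move=> mA; exact: measurable_kernel. Qed.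

Lemma measurable_Rintegral_kernel (f : S -> R) : measurable_fun setT f ->
  measurable_fun setT (fun x => \int[P x]_y f y).
Proof.
move=> mf; apply: measurableT_comp => //.
have -> : (fun x => \int[P x]_y (f y)%:E)%E =
    (fun x => \int[P x]_y ((EFin \o f)^\+ y) - \int[P x]_y ((EFin \o f)^\- y))%E.
  by apply/funext => x; rewrite integralE.
have mf' : measurable_fun setT (EFin \o f) by exact/measurable_EFinP.
by apply: emeasurable_funB; apply: measurable_fun_integral_kernel => //;
  [exact: measurable_funepos|exact: measurable_funeneg].
Qed.

(** Jensen's inequality under each [P x], integrated against the invariant
measure. It holds at every [x]: where [f ^+ 2] is not [P x]-integrable its
right-hand side is infinite. *)
Lemma integral_Rintegral_kernel_sqr_le (f : S -> R) : measurable_fun setT f ->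
  (\int[mu]_x ((\int[P x]_y f y) ^+ 2)%:E <= \int[mu]_x (f x ^+ 2)%:E)%E.
Proof.
move=> mf.
have mf2 : measurable_fun setT (fun x => (f x ^+ 2)%:E).
  exact/measurable_EFinP/measurable_funX.
rewrite -[leRHS]ge0_integral_invariant//; last first.
  by move=> x; rewrite lee_fin sqr_ge0.
apply: ge0_le_integral => //.
- by move=> x _; rewrite lee_fin sqr_ge0.
- by apply/measurable_EFinP/measurable_funX/measurable_Rintegral_kernel.
- apply: measurable_fun_integral_kernel => //.
  by move=> y /=; rewrite lee_fin sqr_ge0.
- by move=> x _; apply: Rintegral_sqr_le => //; exact: prob_kernel.
Qed.

Lemma Lfun2_Rintegral_kernel (u : L2space mu) :
  (fun x => \int[P x]_y u y) \in Lfun mu 2%:E.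
Proof.
apply: mem_Lfun2.
  exact/measurable_Rintegral_kernel/measurable_L2space.
apply: le_lt_trans (L2space_lty u).
exact/integral_Rintegral_kernel_sqr_le/measurable_L2space.
Qed.

Definition markov_op (u : L2space mu) : L2space mu :=
  Lfun_Sub _ (Lfun2_Rintegral_kernel u).

Lemma markov_op_contraction (u : L2space mu) :
  seminorm (@ipL2 _ _ _ mu) (markov_op u) <= seminorm (@ipL2 _ _ _ mu) u.
Proof.
apply: ler_wsqrtr; rewrite -lee_fin !EFin_ipL2.
exact/integral_Rintegral_kernel_sqr_le/measurable_L2space.
Qed.

(** By invariance [x |-> \int[P x] |u|] has the finite integral of [|u|]. *)
Lemma ae_integrable_kernel (u : L2space mu) :
  {ae mu, forall x, (P x).-integrable setT (EFin \o u)}.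
Proof.
have mu' : measurable_fun setT (EFin \o u).
  exact/measurable_EFinP/measurable_L2space.
have mau : measurable_fun setT (fun y => `|(u y)%:E|)%E by exact: measurableT_comp.
have /(integrable_ae measurableT) :
    mu.-integrable setT (fun x => \int[P x]_y `|(u y)%:E|)%E.
  apply/integrableP; split.
    exact: measurable_fun_integral_kernel.
  have /integrableP[_] := integrable_L2space u.
  rewrite -ge0_integral_invariant//.
  by under [in X in _ -> X]eq_integral do rewrite gee0_abs ?integral_ge0//.
apply: filterS => x /(_ I) ufin; apply/integrableP; split => //.
by rewrite ltey_eq ufin.
Qed.

Lemma markov_opD (u v : L2space mu) :
  nulleq (@ipL2 _ _ _ mu) (markov_op (u + v)) (markov_op u + markov_op v).
Proof.
apply: ae_nulleq.
apply: filterS2 (ae_integrable_kernel u) (ae_integrable_kernel v) => x ux vx.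
by rewrite -[RHS]/(\int[P x]_y u y + \int[P x]_y v y) -RintegralD.
Qed.

Lemma ge0_EFin_markov_op (u : L2space mu) : (forall x, 0 <= u x) ->
  {ae mu, forall x, (markov_op u x)%:E = (\int[P x]_y (u y)%:E)%E}.
Proof.
move=> u0; apply: filterS (ae_integrable_kernel u) => x ux.
by rewrite /= /Rintegral fineK//; exact: integrable_fin_num.
Qed.

Lemma meanL2_markov_op (u : L2space mu) : meanL2 (markov_op u) = meanL2 u.
Proof.
have ge0 (v : L2space mu) : (forall x, 0 <= v x) ->
    meanL2 (markov_op v) = meanL2 v.
  move=> v0; rewrite /meanL2 /Rintegral; congr fine.
  have mv : measurable_fun setT (fun x => (v x)%:E).
    exact/measurable_EFinP/measurable_L2space.
  rewrite -[RHS]ge0_integral_invariant//.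
  apply: ae_eq_integral => //.
  - exact/measurable_EFinP/measurable_L2space.
  - by apply: measurable_fun_integral_kernel.
  - by apply: filterS (ge0_EFin_markov_op v0) => x + _.
have MB := meanB (@meanL2_linear _ _ _ mu).
have meq v w : nulleq (@ipL2 _ _ _ mu) v w -> meanL2 v = meanL2 w.
  move=> vw; apply/eqP; rewrite -subr_eq0 -MB -sqrf_eq0 eq_le sqr_ge0 andbT.
  have := Rintegral_sqr_le (@probability_setT _ _ _ mu) (measurable_L2space (v - w)).
  rewrite -EFin_ipL2 lee_fin -(sqr_seminorm (ipL2_semi_inner mu)) vw.
  by rewrite expr0n.
rewrite [in RHS](posL2B u) MB [in LHS](posL2B u).
rewrite (meq _ _ (opB (ipL2_semi_inner mu) markov_opD _ _)) MB.
by rewrite !ge0// => x /=; rewrite ?funrpos_ge0 ?funrneg_ge0.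
Qed.

End MarkovOperator.

(** * Correlations along the stationary chain *)

Section StationaryChain.
Context d d' (S : measurableType d) (Omega : measurableType d') (R : realType).
Context (P : R.-pker S ~> S) (mu : probability S R) (Pr : probability Omega R).
Context (X : nat -> {RV Pr >-> S}).
Hypothesis mu_inv : invariant_measure P mu.
Hypothesis X_markov : markov_chain P X.
Hypothesis X0_mu : forall A, measurable A -> distribution Pr (X 0%N) A = mu A.

Let mX i : measurable_fun setT (X i). Proof. exact: measurable_funPT. Qed.

Let mXA i A : measurable A -> measurable (X i @^-1` A).
Proof. by move=> mA; rewrite -[_ @^-1` _]setTI; exact: mX. Qed.

Let mP A : measurable A -> measurable_fun setT (P ^~ A).
Proof. by move=> mA; exact: measurable_kernel. Qed.

Let mdX i A : measurable A ->
  measurable_fun setT (fun w => \d_(X i w) A : \bar R).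
Proof.
by move=> mA; apply: (measurableT_comp (f := fun x => \d_x A : \bar R)) => //;
  exact: measurable_fun_dirac.
Qed.

(** The law at time [i] enters as a hypothesis because this is used inside the
induction on [i] that proves stationarity. *)
Lemma integral_law_of_law i :
  (forall A, measurable A -> Pr (X i @^-1` A) = mu A) ->
  forall f : S -> \bar R, (forall x, 0 <= f x)%E -> measurable_fun setT f ->
  (\int[Pr]_w f (X i w) = \int[mu]_x f x)%E.
Proof.
move=> law f f0 mf.
transitivity (\int[Pr]_w (cst 1 w * \int[\d_(X i w)]_y f y))%E.
  by apply: eq_integral => w _; rewrite mul1e integral_dirac// diracT mul1e.
transitivity (\int[mu]_x (cst 1 x * \int[\d_x]_y f y))%E; last first.
  by apply: eq_integral => x _; rewrite mul1e integral_dirac// diracT mul1e.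
apply: eq_integral_kernel => //.
- exact: mdX.
- by move=> A mA; exact: measurable_fun_dirac.
move=> A mA; under eq_integral do rewrite mul1e.
under [RHS]eq_integral do rewrite mul1e.
rewrite [RHS]integral_indic// setIT.
transitivity (Pr (X i @^-1` A)); last exact: law.
by rewrite -[in RHS](setIT (X i @^-1` A)) -integral_indic//; exact: mXA.
Qed.

Lemma past_preimage i n A : (i <= n)%N -> measurable A ->
  past (fun i => X i) n (X i @^-1` A).
Proof. by move=> le_in mA; apply: sub_gen_smallest; exists i, A. Qed.

Lemma law_chain i A : measurable A -> Pr (X i @^-1` A) = mu A.
Proof.
elim: i A => [|i IH] A mA; first exact: X0_mu.
transitivity (Pr (X 0%N @^-1` setT `&` X i.+1 @^-1` A)).
  by rewrite preimage_setT setTI.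
rewrite X_markov//; last exact: past_preimage.
rewrite preimage_setT (@integral_law_of_law i _ (P ^~ A))//.
  exact: mu_inv.
exact: mP.
Qed.

Lemma integral_law i (f : S -> \bar R) :
  (forall x, 0 <= f x)%E -> measurable_fun setT f ->
  (\int[Pr]_w f (X i w) = \int[mu]_x f x)%E.
Proof. exact/integral_law_of_law/law_chain. Qed.

Lemma ae_law i (p : S -> Prop) : {ae mu, forall x, p x} ->
  {ae Pr, forall w, p (X i w)}.
Proof.
move=> [N [mN N0 pN]]; exists (X i @^-1` N); split.
- exact: mXA.
- by rewrite law_chain.
- by move=> w /= npw; exact: pN.
Qed.

(** The Markov property gives this identity for two indicators. It extends to
[u] first, with the finite weights [\d_(X n.+1 w) A] and [P (X n w) A], and then
to [v], with the finite weight [u (X i w)]; in the opposite order the weight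
[\int[P (X n w)] v] could be infinite. *)
Lemma integral_markov_ge0 i n (u v : S -> R) : (i <= n)%N ->
  (forall x, 0 <= u x) -> (forall x, 0 <= v x) ->
  measurable_fun setT u -> measurable_fun setT v ->
  (\int[Pr]_w ((u (X i w))%:E * (v (X n.+1 w))%:E) =
   \int[Pr]_w ((u (X i w))%:E * \int[P (X n w)]_y (v y)%:E))%E.
Proof.
move=> le_in u0 v0 mu' mv.
have muX : measurable_fun setT (fun w => (u (X i w))%:E).
  by apply/measurable_EFinP; exact: measurableT_comp.
have mPX A : measurable A -> measurable_fun setT (fun w => P (X n w) A).
  by move=> mA; exact: (measurableT_comp (mP mA)).
transitivity (\int[Pr]_w ((u (X i w))%:E *
    \int[\d_(X n.+1 w)]_y (v y)%:E))%E.
  apply: eq_integral => w _; rewrite integral_dirac// ?diracT ?mul1e//.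
  exact/measurable_EFinP.
apply: (eq_integral_kernel _ _ muX muX) => //.
- exact: mdX.
- by move=> w; rewrite lee_fin.
- by move=> w; rewrite lee_fin.
2: exact/measurable_EFinP.
move=> A mA.
have PAfin w : P (X n w) A \is a fin_num.
  exact: (finite_kernel_measure P).
transitivity (\int[Pr]_w (\d_(X n.+1 w) A * \int[\d_(X i w)]_y (u y)%:E))%E.
  apply: eq_integral => w _; rewrite integral_dirac// ?diracT ?mul1e//.
    by rewrite muleC.
  exact/measurable_EFinP.
transitivity (\int[Pr]_w (P (X n w) A * \int[\d_(X i w)]_y (u y)%:E))%E; last first.
  apply: eq_integral => w _; rewrite integral_dirac// ?diracT ?mul1e//.
    by rewrite muleC.
  exact/measurable_EFinP.
apply: eq_integral_kernel => //.
- exact: mdX.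
- exact: mdX.
- exact: mdX.
- exact: mPX.
2: exact/measurable_EFinP.
move=> C mC.
transitivity (\int[Pr]_(w in X i @^-1` C) P (X n w) A)%E; last first.
  rewrite [LHS]integral_mkcond; apply: eq_integral => w _.
  rewrite patchE -[RHS]/(_ * \d_(X i w) C)%E diracE; case: ifPn => /= wC.
    by rewrite mem_set ?mule1//; exact: set_mem wC.
  by rewrite memNset ?mule0//; move/negP: wC; apply: contra_not => ?; exact: mem_set.
rewrite -X_markov//; last exact: past_preimage.
rewrite -[X in Pr X]setIT -integral_indic//; last first.
  by apply: measurableI; exact: mXA.
apply: eq_integral => w _.
rewrite -[LHS]/(\d_(X n.+1 w) A * \d_(X i w) C)%E !diracE -EFinM -natrM mulnb.
by rewrite indicE in_setI andbC.
Qed.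

Lemma Lfun2_chain i (u : L2space mu) : u \o X i \in Lfun Pr 2%:E.
Proof.
apply: mem_Lfun2; first exact: measurableT_comp (measurable_L2space u) (mX i).
rewrite (@integral_law i (fun x => (u x ^+ 2)%:E)) ?L2space_lty//.
- by move=> x; rewrite lee_fin sqr_ge0.
- exact/measurable_EFinP/measurable_funX/measurable_L2space.
Qed.

Definition chain_L2 i (u : L2space mu) : L2space Pr :=
  Lfun_Sub _ (Lfun2_chain i u).

Local Notation ip := (@ipL2 _ _ _ mu).
Local Notation ipP := (@ipL2 _ _ _ Pr).
Local Notation Q := (markov_op mu_inv).

Lemma chain_L2B i u v : chain_L2 i (u - v) = chain_L2 i u - chain_L2 i v.
Proof. by apply/LfuneqP. Qed.

Lemma chain_L2D i u v : chain_L2 i (u + v) = chain_L2 i u + chain_L2 i v.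
Proof. by apply/LfuneqP. Qed.

Lemma ip_chain_L2 i u : ipP (chain_L2 i u) (chain_L2 i u) = ip u u.
Proof.
apply/EFin_inj; rewrite !EFin_ipL2.
apply: (@integral_law i (fun x => (u x ^+ 2)%:E)).
- by move=> x; rewrite lee_fin sqr_ge0.
- exact/measurable_EFinP/measurable_funX/measurable_L2space.
Qed.

(** Both sides are bilinear, so it is enough to compare them on nonnegative
functions. *)
Lemma ip_chain_L2_next i n (u v : L2space mu) : (i <= n)%N ->
  ipP (chain_L2 i u) (chain_L2 n.+1 v) = ipP (chain_L2 i u) (chain_L2 n (Q v)).
Proof.
move=> le_in.
have ge0 (a b : L2space mu) : (forall x, 0 <= a x) -> (forall x, 0 <= b x) ->
    ipP (chain_L2 i a) (chain_L2 n.+1 b) =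
    ipP (chain_L2 i a) (chain_L2 n (Q b)).
  move=> a0 b0; rewrite /ipL2 /Rintegral; congr fine => /=.
  have ma := measurable_L2space a; have mb := measurable_L2space b.
  transitivity (\int[Pr]_w ((a (X i w))%:E * (b (X n.+1 w))%:E))%E => //.
  rewrite integral_markov_ge0//; apply: ae_eq_integral => //.
  - apply: emeasurable_funM.
      by apply/measurable_EFinP; exact: measurableT_comp.
    apply: (measurableT_comp (f := fun x => \int[P x]_y (b y)%:E)%E) => //.
    apply: measurable_fun_integral_kernel => //.
    exact/measurable_EFinP.
  - apply/measurable_EFinP; apply: measurable_funM; first exact: measurableT_comp.
    apply: (measurableT_comp (f := fun x => \int[P x]_y b y)) => //.
    exact: measurable_Rintegral_kernel.
  - apply: filterS (ae_law n (ge0_EFin_markov_op mu_inv b0)) => w /= h _.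
    by rewrite EFinM h.
have HPr := ipL2_semi_inner Pr.
have QB a b b' : ipP a (chain_L2 n (Q (b - b'))) =
    ipP a (chain_L2 n (Q b)) - ipP a (chain_L2 n (Q b')).
  rewrite -(innerBr HPr) -chain_L2B; apply: (nulleq_inner HPr).
  rewrite /nulleq /seminorm -chain_L2B ip_chain_L2.
  exact: (opB (ipL2_semi_inner mu) (markov_opD mu_inv)).
rewrite (posL2B u) (posL2B v) QB !chain_L2B !(innerBl HPr) !(innerBr HPr).
have pos w x : 0 <= posL2 w x by exact: funrpos_ge0.
have neg w x : 0 <= negL2 w x by exact: funrneg_ge0.
have swap (a b c e : R) : a - b - (c - e) = a - c - (b - e) by ring.
by rewrite !ge0//; exact: swap.
Qed.

(** Each application of [ip_chain_L2_next] moves the later time one step back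
and applies the operator once; at equal times stationarity and polarization
conclude. *)
Lemma ip_chain_L2_corr i j (u v : L2space mu) : (i <= j)%N ->
  ipP (chain_L2 i u) (chain_L2 j v) = ip u (iter (j - i) Q v).
Proof.
move=> /subnKC <-; rewrite addKn; elim: (j - i)%N v => [|k IH] v.
  have := ip_chain_L2 i (u + v); rewrite addn0 chain_L2D.
  rewrite (inner_sqrD (ipL2_semi_inner Pr)) (inner_sqrD (ipL2_semi_inner mu)).
  by rewrite !ip_chain_L2 => /addIr/addrI/mulfI; apply; rewrite pnatr_eq0.
by rewrite addnS ip_chain_L2_next ?leq_addr// IH -iterSr.
Qed.

End StationaryChain.

(** * From real to complex functions *)

Lemma normc_sqr (R : realType) (z : R[i]) :
  ComplexField.Normc.normc z ^+ 2 = complex.Re z ^+ 2 + complex.Im z ^+ 2.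
Proof.
case: z => a b /=; rewrite sqr_sqrtr// addr_ge0 ?sqr_ge0//.
Qed.

Section Complexification.
Context d (T : measurableType d) (R : realType) (mu : {measure set T -> \bar R}).
Local Notation nrm := (seminorm (@ipL2 _ _ _ mu)).

Definition cplxL2 (u v : L2space mu) : T -> R[i] := fun x => (u x +i* v x)%C.

Lemma l2norm_cplxL2 u v :
  l2norm mu (cplxL2 u v) = (Num.sqrt (nrm u ^+ 2 + nrm v ^+ 2))%:E.
Proof.
have B := sqr_seminorm (ipL2_semi_inner mu).
rewrite /l2norm unlock.
have -> : (\int[mu]_x (`|(ComplexField.Normc.normc (cplxL2 u v x))%:E| `^ 2) =
           (nrm u ^+ 2 + nrm v ^+ 2)%:E)%E.
  rewrite !B EFinD !EFin_ipL2 -ge0_integralD//.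
  - apply: eq_integral => x _.
    rewrite /= powR_mulrn// real_normK ?num_real//.
    by rewrite sqr_sqrtr ?addr_ge0 ?sqr_ge0.
  - by move=> x _; rewrite lee_fin sqr_ge0.
  - exact/measurable_EFinP/measurable_funX/measurable_L2space.
  - by move=> x _; rewrite lee_fin sqr_ge0.
  - exact/measurable_EFinP/measurable_funX/measurable_L2space.
by rewrite /= powR12_sqrt// addr_ge0 ?sqr_ge0.
Qed.

Lemma cplxL2_L2 u v : L2 mu (cplxL2 u v).
Proof.
split; last by rewrite l2norm_cplxL2 ltry.
by split => /=; exact: measurable_L2space.
Qed.

Lemma L2_cplxL2 (g : T -> R[i]) : L2 mu g -> exists u v, g = cplxL2 u v.
Proof.
move=> [[mRe mIm] gy].
have mN : measurable_fun setT (fun x => ComplexField.Normc.normc (g x)).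
  have -> : (fun x => ComplexField.Normc.normc (g x)) =
      (fun x => Num.sqrt (complex.Re (g x) ^+ 2 + complex.Im (g x) ^+ 2)).
    by apply/funext => x; case: (g x).
  apply: measurableT_comp => //.
    exact: continuous_measurable_fun (@sqrt_continuous R).
  by apply: measurable_funD; exact: measurable_funX.
have Ny : (\int[mu]_x (ComplexField.Normc.normc (g x) ^+ 2)%:E < +oo)%E.
  suff /Lfun2_integrable_sqr/integrableP[_] :
      (fun x => ComplexField.Normc.normc (g x)) \in Lfun mu 2%:E.
    by under eq_integral do rewrite /= ger0_norm ?sqr_ge0//.
  by rewrite inE; apply/andP; split; rewrite inE.
have le (p : R[i] -> R) : measurable_fun setT (fun x => p (g x)) ->
    (forall z, p z ^+ 2 <= ComplexField.Normc.normc z ^+ 2) ->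
    (fun x => p (g x)) \in Lfun mu 2%:E.
  move=> mp lep; apply: mem_Lfun2 => //.
  apply: le_lt_trans Ny; apply: ge0_le_integral => //.
  - by move=> x _; rewrite lee_fin sqr_ge0.
  - exact/measurable_EFinP/measurable_funX.
  - exact/measurable_EFinP/measurable_funX.
  - by move=> x _; rewrite lee_fin.
have lRe : (fun x => complex.Re (g x)) \in Lfun mu 2%:E.
  by apply: le => // z; rewrite normc_sqr lerDl sqr_ge0.
have lIm : (fun x => complex.Im (g x)) \in Lfun mu 2%:E.
  by apply: le => // z; rewrite normc_sqr lerDr sqr_ge0.
exists (Lfun_Sub (lee1n 2) lRe), (Lfun_Sub (lee1n 2) lIm).
by apply/funext => x; rewrite /cplxL2 /=; case: (g x).
Qed.

Lemma cplxL2_ae0 u v : {ae mu, forall x, cplxL2 u v x = 0} ->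
  nrm u = 0 /\ nrm v = 0.
Proof.
move=> uv0.
have z (w : L2space mu) : {ae mu, forall x, w x = 0} -> nrm w = 0.
  move=> w0; have : nulleq (@ipL2 _ _ _ mu) w 0 by exact: ae_nulleq.
  by rewrite /nulleq subr0.
by split; apply: z; apply: filterS uv0 => x [].
Qed.

Lemma seminorm_ae0 (w : L2space mu) :
  nrm w = 0 -> {ae mu, forall x, w x = 0}.
Proof.
move=> w0; have : (\int[mu]_x `|(w x ^+ 2)%:E| = 0)%E.
  under eq_integral do rewrite /= ger0_norm ?sqr_ge0//.
  by rewrite -EFin_ipL2 -(sqr_seminorm (ipL2_semi_inner mu)) w0 expr0n.
move/ae_eq_integral_abs => /(_ measurableT) h.
have /h : measurable_fun setT (fun x => (w x ^+ 2)%:E).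
  exact/measurable_EFinP/measurable_funX/measurable_L2space.
by apply: filterS => x /(_ I)[] /eqP; rewrite sqrf_eq0 => /eqP.
Qed.

Lemma cplxL2_ae0P u v : {ae mu, forall x, cplxL2 u v x = 0} <->
  l2norm mu (cplxL2 u v) = 0%E.
Proof.
rewrite l2norm_cplxL2; split=> [/cplxL2_ae0[-> ->]|[]].
  by rewrite expr0n addr0 sqrtr0.
move/eqP; rewrite sqrtr_eq0 => uv0.
have u2 := sqr_ge0 (nrm u); have v2 := sqr_ge0 (nrm v).
have /seminorm_ae0 u0 : nrm u = 0 by apply/eqP; rewrite -sqrf_eq0; lra.
have /seminorm_ae0 v0 : nrm v = 0 by apply/eqP; rewrite -sqrf_eq0; lra.
by apply: filterS2 u0 v0 => x; rewrite /cplxL2 => -> ->.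
Qed.

End Complexification.

Section Spectral.
Context d (S : measurableType d) (R : realType).
Context (P : R.-pker S ~> S) (mu : probability S R).
Hypothesis mu_inv : invariant_measure P mu.
Local Notation nrm := (seminorm (@ipL2 _ _ _ mu)).
Local Notation Q := (markov_op mu_inv).

Lemma cintegral_cplxL2 (u v : L2space mu) :
  cintegral mu (cplxL2 u v) = (meanL2 u +i* meanL2 v)%C.
Proof. by []. Qed.

Lemma L20_cplxL2 (g : S -> R[i]) : L20 mu g -> exists u v : L2space mu,
  [/\ g = cplxL2 u v, meanL2 u = 0 & meanL2 v = 0].
Proof.
move=> [/L2_cplxL2[u [v ->]]]; rewrite cintegral_cplxL2 => -[u0 v0].
by exists u, v.
Qed.

Lemma cplxL2_L20 (u v : L2space mu) :
  meanL2 u = 0 -> meanL2 v = 0 -> L20 mu (cplxL2 u v).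
Proof.
by move=> u0 v0; split; [exact: cplxL2_L2|rewrite cintegral_cplxL2 u0 v0].
Qed.

Lemma kernel_op_cplxL2 (u v : L2space mu) :
  (fun x => kernel_op P (cplxL2 u v) x - cplxL2 u v x) =
  cplxL2 (Q u - u) (Q v - v).
Proof. by apply/funext. Qed.

(** The spectral gap is used on real functions only, as the complex ones with
zero imaginary part. When [nrm u = 0] the function is not in the family over
which the infimum is taken, and the inequality is trivial. *)
Lemma seminorm_gap (c : R) (u : L2space mu) : (c%:E <= gamma P mu)%E ->
  meanL2 u = 0 -> c * nrm u <= nrm (Q u - u).
Proof.
move=> cg u0; have [->|Nu] := eqVneq (nrm u) 0.
  by rewrite mulr0 seminorm_ge0.
have m0 : meanL2 (0 : L2space mu) = 0 by exact: (mean0 (@meanL2_linear _ _ _ mu)).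
have N0 : nrm 0 = 0 := seminorm0 (ipL2_semi_inner mu).
have : (gamma P mu <= l2norm mu (cplxL2 (Q u - u)%R (Q 0 - 0)%R) /
   l2norm mu (cplxL2 u 0%R))%E.
  apply: ereal_inf_lbound; exists (cplxL2 u 0).
    by split; [exact: cplxL2_L20|move=> /cplxL2_ae0[]; move/eqP: Nu].
  by rewrite -kernel_op_cplxL2.
have NQ0 : nrm (Q 0 - 0) = 0.
  apply/eqP; rewrite eq_le seminorm_ge0 andbT subr0.
  by rewrite (le_trans (markov_op_contraction _ _))// N0.
rewrite !l2norm_cplxL2 N0 NQ0 expr0n !addr0 !sqrtr_sqr.
rewrite !ger0_norm ?seminorm_ge0// inver (negbTE Nu) => /(le_trans cg).
by rewrite lee_fin ler_pdivlMr// lt_def Nu seminorm_ge0.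
Qed.

(** The Markov operator acts on real and imaginary parts separately and squared
norms add up, so that a gap for real functions is one for complex functions. *)
Lemma gamma_ge (c : R) : 0 <= c ->
  (forall u : L2space mu, meanL2 u = 0 -> c * nrm u <= nrm (Q u - u)) ->
  (c%:E <= gamma P mu)%E.
Proof.
move=> c0 gap; apply: le_ereal_inf_tmp.
move=> _ [f [/L20_cplxL2[u [v [-> u0 v0]]] f0] <-].
rewrite kernel_op_cplxL2 !l2norm_cplxL2.
set r := Num.sqrt (nrm u ^+ 2 + _).
have [r0|rN0] := eqVneq r 0.
  by exfalso; apply: f0; apply/cplxL2_ae0P; rewrite l2norm_cplxL2 -/r r0.
rewrite inver (negbTE rN0) lee_fin ler_pdivlMr; last first.
  by rewrite lt_def rN0 sqrtr_ge0.
rewrite -{1}(ger0_norm c0) -sqrtr_sqr -sqrtrM ?sqr_ge0//.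
apply: ler_wsqrtr; rewrite mulrDr -!exprMn.
by rewrite lerD// ler_sqr ?nnegrE ?mulr_ge0 ?seminorm_ge0// gap.
Qed.

(** The ratio at [g] is a finite upper bound of the infimum, so that an infinite
gap leaves no function over which to take the supremum in [Delta]. *)
Lemma gamma_lty (g : S -> R[i]) : L20 mu g -> l2norm mu g = 1%E ->
  (gamma P mu < +oo)%E.
Proof.
move=> /L20_cplxL2[u [v [-> u0 v0]]] g1.
apply: (@le_lt_trans _ _ (l2norm mu (cplxL2 (Q u - u)%R (Q v - v)%R) /
   l2norm mu (cplxL2 u v)))%E.
  apply: ereal_inf_lbound; exists (cplxL2 u v).
    split; first exact: cplxL2_L20.
    by move=> /cplxL2_ae0P/eqP; rewrite g1 onee_eq0.
  by rewrite -kernel_op_cplxL2.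
by rewrite g1 inve1 mule1 l2norm_cplxL2 ltry.
Qed.

End Spectral.

(** * Variance of empirical means *)

Section Variance.
Context d d' (S : measurableType d) (Omega : measurableType d') (R : realType).
Context (P : R.-pker S ~> S) (mu : probability S R) (Pr : probability Omega R).
Context (X : nat -> {RV Pr >-> S}).
Hypothesis mu_inv : invariant_measure P mu.
Hypothesis X_markov : markov_chain P X.
Hypothesis X0_mu : forall A, measurable A -> distribution Pr (X 0%N) A = mu A.
Local Notation nrm := (seminorm (@ipL2 _ _ _ mu)).
Local Notation nrmP := (seminorm (@ipL2 _ _ _ Pr)).
Local Notation Q := (markov_op mu_inv).
Local Notation U := (chain_L2 mu_inv X_markov X0_mu).

Lemma path_sumE n (u : L2space mu) w :
  path_sum U n u w = \sum_(i < n) u (X i w).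
Proof.
by rewrite /path_sum (big_morph (fun f : L2space Pr => f w)
  (id1 := 0) (op1 := +%R)).
Qed.

Lemma path_sumZ n a (u : L2space mu) :
  path_sum U n (a *: u) = a *: path_sum U n u.
Proof.
apply/LfuneqP => w; rewrite path_sumE -[RHS]/(a * path_sum U n u w).
rewrite !path_sumE mulr_sumr.
by [].
Qed.

Lemma empirical_mean_cplxL2 n (u v : L2space mu) w :
  empirical_mean X n (cplxL2 u v) w =
  ((n%:R^-1 * path_sum U n u w) +i* (n%:R^-1 * path_sum U n v w))%C.
Proof.
have E (z : R[i]) : n%:R^-1 * z =
    ((n%:R^-1 * complex.Re z) +i* (n%:R^-1 * complex.Im z))%C.
  have -> : n%:R^-1 = (n%:R^-1)%:C%C :> R[i] by rewrite fmorphV rmorph_nat.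
  by case: z => a b; simpc.
rewrite /empirical_mean E; congr (_ * _ +i* (_ * _))%C.
- by rewrite path_sumE raddf_sum; apply: eq_bigr.
- by rewrite path_sumE raddf_sum; apply: eq_bigr.
Qed.

Lemma Var_cplxL2 n (u v : L2space mu) : meanL2 u = 0 -> meanL2 v = 0 ->
  Var mu X n (cplxL2 u v) =
  (n%:R ^- 2 * (nrmP (path_sum U n u) ^+ 2 + nrmP (path_sum U n v) ^+ 2))%:E.
Proof.
move=> u0 v0; have B := sqr_seminorm (ipL2_semi_inner Pr).
rewrite EFinM !B EFinD !EFin_ipL2 /Var unlock -ge0_integralD//; last first.
- exact/measurable_EFinP/measurable_funX/measurable_L2space.
- by move=> x _; rewrite lee_fin sqr_ge0.
- exact/measurable_EFinP/measurable_funX/measurable_L2space.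
- by move=> x _; rewrite lee_fin sqr_ge0.
rewrite -ge0_integralZl//; last first.
- by move=> x _; rewrite -EFinD lee_fin addr_ge0 ?sqr_ge0.
- by apply: emeasurable_funD;
    exact/measurable_EFinP/measurable_funX/measurable_L2space.
apply: eq_integral => w _.
rewrite cintegral_cplxL2 u0 v0 -EFinD -EFinM; congr EFin.
rewrite empirical_mean_cplxL2 normc_sqr /= !subr0 !exprMn -exprVn.
by rewrite mulrDr.
Qed.

Lemma sqrte_Var_cplxL2 n (u v : L2space mu) : meanL2 u = 0 -> meanL2 v = 0 ->
  sqrte (Var mu X n (cplxL2 u v)) = (n%:R^-1 * Num.sqrt
    (nrmP (path_sum U n u) ^+ 2 + nrmP (path_sum U n v) ^+ 2))%:E.
Proof.
move=> u0 v0; rewrite Var_cplxL2//= -exprVn sqrtrM ?sqr_ge0// sqrtr_sqr.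
by rewrite ger0_norm// invr_ge0.
Qed.

Lemma Delta_le (c : R) n : (0 < n)%N -> 0 < c -> (c%:E <= gamma P mu)%E ->
  (Delta mu X n <= (2 / Num.sqrt (c * n%:R))%:E)%E.
Proof.
move=> n0 c0 cg; apply: ge_ereal_sup => _ [->|[g [g0 g1] <-]].
  by rewrite lee_fin divr_ge0.
have [u [v [gE u0 v0]]] := L20_cplxL2 g0; move: g1; rewrite gE {g g0 gE}.
rewrite l2norm_cplxL2 sqrte_Var_cplxL2// => -[uv1].
have gap w := @seminorm_gap _ _ _ _ _ mu_inv c w cg.
have le w : meanL2 w = 0 ->
    nrmP (path_sum U n w) ^+ 2 <= 4 * n%:R / c * nrm w ^+ 2.
  move=> w0; rewrite !sqr_seminorm; try exact: ipL2_semi_inner.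
  apply: (path_sum_le (ipL2_semi_inner mu) (markov_opD mu_inv)
    (markov_op_contraction mu_inv) (@meanL2_linear _ _ _ mu)
    (meanL2_markov_op mu_inv) (ipL2_semi_inner Pr)) => // i j a b.
  exact: ip_chain_L2_corr.
have n0R : 0 < n%:R :> R by rewrite ltr0n.
rewrite lee_fin ler_pdivlMr ?sqrtr_gt0 ?mulr_gt0// -mulrA.
rewrite ler_pdivrMl// -sqrtrM ?addr_ge0 ?sqr_ge0//.
have -> : n%:R * 2 = Num.sqrt ((n%:R * 2) ^+ 2) :> R.
  by rewrite sqrtr_sqr ger0_norm// mulr_ge0.
apply: ler_wsqrtr.
have {}uv1 : nrm u ^+ 2 + nrm v ^+ 2 = 1.
  by rewrite -[LHS]sqr_sqrtr ?addr_ge0 ?sqr_ge0// uv1 expr1n.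
apply: (@le_trans _ _ ((4 * n%:R / c * (nrm u ^+ 2 + nrm v ^+ 2)) * (c * n%:R))).
  by rewrite ler_wpM2r ?mulr_ge0 ?(ltW c0)// mulrDr lerD ?le.
rewrite uv1 le_eqVlt; apply/orP; left; apply/eqP; field.
exact: lt0r_neq0.
Qed.

Lemma seminorm_path_sum_le (e : R) k (u : L2space mu) : (0 < k)%N ->
  (Delta mu X k <= e%:E)%E -> meanL2 u = 0 -> 0 < nrm u ->
  nrmP (path_sum U k u) <= k%:R * e * nrm u.
Proof.
move=> k0 De u0 Nu.
have k0R : 0 < k%:R :> R by rewrite ltr0n.
have m0 : meanL2 (0 : L2space mu) = 0 by exact: (mean0 (@meanL2_linear _ _ _ mu)).
have N0 : nrm 0 = 0 := seminorm0 (ipL2_semi_inner mu).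
pose v := (nrm u)^-1 *: u.
have v0 : meanL2 v = 0.
  by have := meanL2_linear (nrm u)^-1 u 0; rewrite addr0 u0 m0 mulr0 addr0.
have v1 : nrm v = 1.
  rewrite (seminormZ (ipL2_semi_inner mu)) ger0_norm ?invr_ge0 ?seminorm_ge0//.
  by rewrite mulVf// lt0r_neq0.
have : (sqrte (Var mu X k (cplxL2 v 0%R)) <= e%:E)%E.
  apply: le_trans De; apply: ereal_sup_ubound; right; exists (cplxL2 v 0) => //.
  split; first exact: cplxL2_L20.
  by rewrite l2norm_cplxL2 v1 N0 expr1n expr0n addr0 sqrtr1.
have p0 : path_sum U k 0 = 0.
  by rewrite -(scale0r 0) path_sumZ scale0r.
rewrite sqrte_Var_cplxL2// p0 (seminorm0 (ipL2_semi_inner Pr)) expr0n addr0.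
rewrite sqrtr_sqr ger0_norm ?seminorm_ge0// lee_fin ler_pdivrMl//.
rewrite path_sumZ (seminormZ (ipL2_semi_inner Pr)).
by rewrite ger0_norm ?invr_ge0 ?seminorm_ge0// ler_pdivrMl// mulrC.
Qed.

(** [Delta k <= e] bounds path sums, hence orbit sums, by [k e] times the
seminorm, which is what [gap_of_orbit_sum] requires. *)
Lemma gamma_ge_of_Delta_le (e : R) n : (0 < n)%N -> 0 < e <= 1 ->
  (forall k, (n <= k <= 2 * n)%N -> (Delta mu X k <= e%:E)%E) ->
  (((1 - e) / (2 * n%:R * e))%:E <= gamma P mu)%E.
Proof.
move=> n0 /andP[e0 e1] De.
have n0R : 0 < n%:R :> R by rewrite ltr0n.
have ne0 : 0 < 2 * n%:R * e by rewrite !mulr_gt0.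
apply: (@gamma_ge _ _ _ _ _ mu_inv).
  by rewrite divr_ge0 ?subr_ge0// ltW.
move=> u u0; rewrite mulrAC ler_pdivrMr// [leRHS]mulrC.
apply: (gap_of_orbit_sum (ipL2_semi_inner mu) (markov_opD mu_inv)
    (markov_op_contraction mu_inv) (@meanL2_linear _ _ _ mu)
    (meanL2_markov_op mu_inv) n0 _ (ltW e0)) => // k v kn v0.
have corr := @ip_chain_L2_corr _ _ _ _ _ _ _ _ _ mu_inv X_markov X0_mu.
have k0 : (0 < k)%N by case/andP: kn => /(leq_trans n0).
have [Nv|Nv] := eqVneq (nrm v) 0.
  rewrite Nv mulr0 -(mulr0 k%:R) -Nv.
  exact: (orbit_sum_bound (ipL2_semi_inner mu) (markov_op_contraction mu_inv)).
rewrite (le_trans (orbit_sum_le_path_sum (ipL2_semi_inner mu)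
  (ipL2_semi_inner Pr) corr k v))//.
by apply: seminorm_path_sum_le => //; [exact: De|rewrite lt_def Nv seminorm_ge0].
Qed.

End Variance.

(** * The two bounds *)

Local Open Scope ereal_scope.

Theorem theorem2 (R : realType) (d d' : measure_display)
    (S : measurableType d) (P : R.-pker S ~> S) (mu : probability S R)
    (Omega : measurableType d') (Pr : probability Omega R)
    (X : nat -> {RV Pr >-> S})
    (mu_invariant : invariant_measure P mu)
    (X_markov : markov_chain P X)
    (X0_mu : forall A, measurable A -> distribution Pr (X 0%N) A = mu A)
    (gamma_gt0 : 0 < gamma P mu)
    (n : nat) (n_ge1 : (1 <= n)%N) :
  Delta mu X n <= 2%:E / sqrte (gamma P mu * n%:R%:E) /\
  1 / (2%:E * gamma P mu * n%:R%:E + 3%:E) <=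
    \big[maxe/-oo]_(n <= k < (2 * n).+1) Delta mu X k.
Proof.
have n0R : (0 < n%:R :> R)%R by rewrite ltr0n.
have Delta_ge0 k : 0 <= Delta mu X k by apply: ereal_sup_ubound; left.
have Delta_le_max k : (n <= k <= 2 * n)%N ->
    Delta mu X k <= \big[maxe/-oo]_(n <= k < (2 * n).+1) Delta mu X k.
  move=> kn; apply: (@Order.TotalTheory.bigmax_sup_seq _ _ _ _ _ k) => //.
  by rewrite mem_index_iota.
have max_ge0 : 0 <= \big[maxe/-oo]_(n <= k < (2 * n).+1) Delta mu X k.
  by apply: le_trans (Delta_le_max n _) => //; rewrite leqnn mul2n -addnn leq_addr.
case gE : (gamma P mu) gamma_gt0 => [c| |] c0//.
- split.
    apply: (le_trans (Delta_le mu_invariant X_markov X0_mu n_ge1 (c := c) _ _)).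
    + by [].
    + by rewrite gE.
    + by rewrite -EFinM /= inver gt_eqF// sqrtr_gt0 mulr_gt0.
  rewrite -!EFinM -EFinD mul1e inver gt_eqF; last first.
    by rewrite addr_gt0// !mulr_gt0.
  rewrite leNgt; apply/negP => lt_max.
  have mfin : \big[maxe/-oo]_(n <= k < (2 * n).+1) Delta mu X k \is a fin_num.
    by rewrite ge0_fin_numE// (lt_trans lt_max)// ltry.
  move: lt_max max_ge0 Delta_le_max; rewrite -(fineK mfin).
  set m := fine _; rewrite lte_fin lee_fin => lt_m m0 Dm.
  set b := (2 * c * n%:R + 3)%R in lt_m.
  have cn0 : (0 < c * n%:R)%R by rewrite mulr_gt0.
  have b3 : (3 < b)%R by rewrite /b -mulrA; lra.
  have b0 : (0 < b)%R by lra.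
  (* any value strictly between the maximum and the claimed bound; unlike [m]
     it is positive, so that one can divide by it *)
  pose e := ((m + b^-1) / 2)%R.
  have bi0 : (0 < b^-1)%R by rewrite invr_gt0.
  have e0 : (0 < e)%R by rewrite /e; lra.
  have eb : (e < b^-1)%R by rewrite /e; lra.
  have b1 : (b^-1 <= 1)%R by rewrite invf_le1//; lra.
  have e1 : (e <= 1)%R by lra.
  have := gamma_ge_of_Delta_le mu_invariant X_markov X0_mu n_ge1 (e := e).
  rewrite e0 e1 gE => /(_ isT) h.
  have : (((1 - e) / (2 * n%:R * e))%:E <= c%:E).
    apply: h => k kn; apply: le_trans (Dm _ kn) _.
    by rewrite lee_fin /e; lra.
  have ne0 : (0 < 2 * n%:R * e)%R by rewrite mulr_gt0// mulr_gt0.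
  rewrite lee_fin ler_pdivrMr//.
  have : (e * b < 1)%R by rewrite -ltr_pdivlMr// div1r.
  by rewrite /b; lra.
- split.
    have -> : Delta mu X n = 0.
      apply/eqP; rewrite eq_le Delta_ge0 andbT.
      apply: ge_ereal_sup => _ [->//|[g [g0 g1] <-]].
      by have := gamma_lty mu_invariant g0 g1; rewrite gE ltxx.
    rewrite mulyr gtr0_sg// mul1e /= invey mule0//.
  rewrite gt0_muley ?lte_fin// gt0_mulye ?lte_fin// addye// invey mule0.
  exact: max_ge0.
Qed.
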